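(* Let $P=(X,\prec)$ be a finite poset of width two with $n=|X|$ elements, let $X=\mathcal{C}_1\sqcup\mathcal{C}_2$ be a fixed partition into two chains $\mathcal{C}_1=\{\alpha_1\prec\cdots\prec\alpha_{a}\}$ and $\mathcal{C}_2=\{\beta_1\prec\cdots\prec\beta_{b}\}$, and let $x,y\in X$ be distinct elements such that either $x,y\in\mathcal{C}_1$ or $x,y\in\mathcal{C}_2$. For an integer $k$ define $$F_q(k)\;:=\;\sum_{L\in\mathcal{E}(P)\,:\,L(y)-L(x)=k} q^{\mathrm{wgt}(L)}\in\mathbb{Z}[q].$$ Then $$F_q(k)^2\;\geqslant\;F_q(k-1)\,F_q(k+1)\qquad\text{for all } k>1,$$ where the inequality between polynomials in $q$ is coefficient-wise.
   Context: A linear extension of $P$ is a bijection $L:X\to\{1,\dots,n\}$ such that $L(u)<L(v)$ whenever $u\prec v$; $\mathcal{E}(P)$ denotes the set of linear extensions. The weight of $L$ is $\mathrm{wgt}(L):=\sum_{i=1}^{a}L(\alpha_i)$. For polynomials $f,g\in\mathbb{Z}[q]$, $f\leqslant g$ means $g-f$ has nonnegative coefficients. *)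

(* Defs.v *)
From mathcomp Require Import all_boot all_order all_algebra.

Set Implicit Arguments.
Unset Strict Implicit.
Unset Printing Implicit Defensive.

Import Order.TTheory GRing.Theory Num.Theory.
Local Open Scope ring_scope.

Section Poset.

Variables (d : Order.disp_t) (X : finPOrderType d).

Definition antichain (A : {set X}) : bool :=
  [forall u in A, forall v in A, (u != v) ==> (u >< v)%O].

Definition width : nat := (\max_(A : {set X} | antichain A) #|A|)%N.

(* The target {1, ..., n} is encoded by 'I_n; [label] adds 1 back, so that
   the values (and hence the weights) are those of a map to {1, ..., n}. *)
Definition label (L : {ffun X -> 'I_#|X|}) (u : X) : nat := (L u).+1.

Definition linear_extensions : {set {ffun X -> 'I_#|X|}} :=
  [set L : {ffun X -> 'I_#|X|} |
    [&& injectiveb L, [forall j, exists u, L u == j]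
      & [forall u, forall v, (u < v)%O ==> (label L u < label L v)%N]]].

Definition increasing_chain (a : nat) (alpha : 'I_a -> X) : Prop :=
  forall i j : 'I_a, (i < j)%N -> (alpha i < alpha j)%O.

Definition chain_set (a : nat) (alpha : 'I_a -> X) : {set X} :=
  [set alpha i | i : 'I_a].

Definition wgt (a : nat) (alpha : 'I_a -> X) (L : {ffun X -> 'I_#|X|}) : nat :=
  (\sum_(i < a) label L (alpha i))%N.

Definition Fq (a : nat) (alpha : 'I_a -> X) (x y : X) (k : int) : {poly int} :=
  \sum_(L in linear_extensions | (label L y)%:Z - (label L x)%:Z == k)
    'X^(wgt alpha L).

End Poset.

Arguments width {d} X.
Arguments linear_extensions {d} X.

Definition poly_le (f g : {poly int}) : Prop := forall i : nat, 0 <= (g - f)`_i.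

(* Main.v *)
Require Import Defs.
From mathcomp Require Import all_boot all_order all_algebra.
From mathcomp Require Import zify.

Set Implicit Arguments.
Unset Strict Implicit.
Unset Printing Implicit Defensive.

Import Order.TTheory GRing.Theory Num.Theory.
Local Open Scope ring_scope.

(** A linear extension [L] is determined by [f := L o alpha], and the sequences
    [f] that arise are the strictly increasing ones subject to one interval
    constraint on each entry.  A coefficient of [F k1 * F k2] thus counts pairs
    [(f, g)] of such sequences, and it is enough to compare pairs with the same
    entrywise sum [sg = f + g].  Put [z := f - g = 2 f - sg].  The constraints
    on the pair become [`|z i| <= w i] and [`|z i - z j| <= c i j], and the gaps
    are [(k + 1, k - 1)], resp. [(k, k)], according as [z t - z s] is [2] or [0].

    Let [W p r] be the number of admissible [z] with [z s = p] and [z t = r].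
    Reflecting [z] in the level [p + 1 >= 0] on a suitable neighbourhood of [t]
    gives [W p (p + 2) <= W p p], and likewise [W (p + 2) p <= W p p];
    exchanging two admissible [z] on such a neighbourhood gives
    [W p (p + 2) * W (p + 2) p <= W p p * W (p + 2) (p + 2)].  These three
    inequalities imply
    [W p (p + 2) + W (p + 2) p <= W p p + W (p + 2) (p + 2)], first for
    [p >= -1] and then, by the symmetry [z -> - z], for every [p].  Summing over
    [p] and using the symmetry once more yields the comparison.  If [x] and [y]
    lie on the chain [beta], exchange the roles of the chains: the weights of
    [L] along [alpha] and [beta] add up to a constant. *)

(** * Pairs with a fixed entrywise sum *)

(** Expanding [(A - B) * (A - C) >= 0] and using the minor inequality gives
    [A * (B + C) <= A * (A + D)]; then cancel [A], the case [A = 0] being trivial. *)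
Lemma addn_le_of_minor (A B C D : nat) :
  (B <= A -> C <= A -> B * C <= A * D -> B + C <= A + D)%N.
Proof.
move=> /subnKC <-; move: (A - B)%N => u CA BC.
have [A0|A_gt0] := posnP (B + u)%N; first by lia.
rewrite -addnA leq_add2l -(leq_pmul2l A_gt0) mulnDr mulnDl addnC.
by rewrite leq_add // mulnC leq_mul2r CA orbT.
Qed.

(** The shift by [M] lets the ordinals below [K] index the integer window from [- M] to
    [K - M - 1]. *)
Lemma sum_card_fiber_le (T : finType) (A : {set T}) (key : T -> int)
    (M : int) (K : nat) :
  (\sum_(i < K) #|[set f in A | (key f == i%:Z - M)%R]| <= #|A|)%N.
Proof.
under eq_bigr => i _ do rewrite -sum1dep_card big_mkcondr /=.
rewrite exchange_big -sum1_card leq_sum //= => f _.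
have [i0 /eqP fi0|no_i] := pickP (fun i : 'I_K => key f == i%:Z - M).
  rewrite (bigD1 i0) //= big1 ?addn0; first by case: ifP.
  by move=> i; case: ifP => // /eqP; rewrite fi0 -val_eqE /=; lia.
by rewrite big1 // => i _; rewrite no_i.
Qed.

Lemma card_le_sum_fiber (T : finType) (A : {set T}) (key : T -> int)
    (M : int) (K : nat) :
  (forall f, f \in A -> 0 <= key f + M < K%:Z) ->
  (#|A| <= \sum_(i < K) #|[set f in A | (key f == i%:Z - M)%R]|)%N.
Proof.
move=> keyP; under eq_bigr => i _ do rewrite -sum1dep_card big_mkcondr /=.
rewrite exchange_big -sum1_card leq_sum //= => f fA.
have lt_fK : (absz (key f + M)%R < K)%N by have := keyP f fA; lia.
rewrite (bigD1 (Ordinal lt_fK)) //= (_ : key f == _) //.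
by have := keyP f fA; lia.
Qed.

Section Deviation.

Variables (V : finType) (n : nat) (sg : V -> int).
Variables (box : V -> int -> bool) (c : V -> V -> int).

Hypothesis c_sym : forall i j, c i j = c j i.
(** This is the bound [|z i| <= w i] without naming [w i]: the box is closed under moving towards
    its centre [sg i / 2]. *)
Hypothesis box_closed : forall i (v w : int),
  `|2 * w - sg i| <= `|2 * v - sg i| -> box i v -> box i w.
Hypothesis box_range : forall i v, box i v -> 0 <= v < n%:Z.

Implicit Types (f g : {ffun V -> 'I_n}) (s t : V) (p r : int).

Definition dev f i : int := 2 * (f i)%:Z - sg i.

Definition admissible : {set {ffun V -> 'I_n}} :=
  [set f : {ffun V -> 'I_n} | [forall i, box i (f i)%:Z]
    & [forall i, forall j, `|dev f i - dev f j| <= c i j]].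

Lemma admissibleP f :
  reflect ((forall i, box i (f i)%:Z)
           /\ (forall i j, `|dev f i - dev f j| <= c i j))
          (f \in admissible).
Proof.
rewrite inE; apply: (iffP andP) => -[H1 H2]; split.
- exact/forallP.
- by move=> i j; move/forallP/(_ i)/forallP/(_ j): H2.
- exact/forallP.
- by apply/forallP => i; apply/forallP => j.
Qed.

(** Its cardinality is the number [W p r]. *)
Definition pinned s t p r : {set {ffun V -> 'I_n}} :=
  [set f in admissible | dev f s == p & dev f t == r].

Lemma pinnedP s t p r f :
  reflect [/\ f \in admissible, dev f s = p & dev f t = r]
          (f \in pinned s t p r).
Proof.
rewrite !inE; apply: (iffP and3P) => -[H /eqP? /eqP?]; split=> //; exact/eqP.
Qed.

Lemma pinnedC s t p r : pinned s t p r = pinned t s r p.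
Proof. by apply/setP => f; rewrite !inE [(dev f s == p) && _]andbC. Qed.

(* Meaningful only where [0 <= h i < n]; see [retargetE]. *)
Definition retarget f (h : V -> int) : {ffun V -> 'I_n} :=
  [ffun i => insubd (f i) `|h i|%N].

Lemma retargetE f h i : 0 <= h i < n%:Z -> (retarget f h i)%:Z = h i.
Proof. by move=> hi; rewrite ffunE val_insubd; case: ifP; lia. Qed.

(** * Reflection in a level *)

Section Reflection.

Variable lam : int.

(* [rigid f i j] says that reflecting [dev f] in [lam] at only one of [i], [j]
   violates the constraint between them, so that the connected components of
   [rigid f] are the smallest sets on which [f] can be reflected.  Reflection
   does not change the relation, which makes it an involution. *)
Definition rigid f : rel V :=
  fun i j => c i j < `|2 * lam - dev f i - dev f j|.

Lemma rigid_sym f i j : rigid f i j = rigid f j i.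
Proof. by rewrite /rigid c_sym [X in `|X|]addrAC. Qed.

(** If [lam] separates [dev f k] from [dev f l], then [|2 * lam - dev f k - dev f l|] is at most
    [|dev f k - dev f l| <= c k l], so [k] and [l] are not joined by [rigid f]. *)
Lemma rigid_above f i j : f \in admissible -> connect (rigid f) i j ->
  (lam < dev f i) = (lam < dev f j).
Proof.
move=> /admissibleP[_ fc].
apply: (@closed_connect _ (rigid f) [pred k | lam < dev f k]) => k l.
by rewrite !inE /rigid; have := fc k l; lia.
Qed.

(** The map [f i -> sg i + lam - f i] is [z -> 2 * lam - z] on deviations. *)
Definition mirror t f : {ffun V -> 'I_n} :=
  retarget f (fun i => if connect (rigid f) t i then sg i + lam - (f i)%:Z
                       else (f i)%:Z).

Hypothesis lam_ge0 : 0 <= lam.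

Section Above.

Variables (t : V) (f : {ffun V -> 'I_n}).
Hypotheses (f_adm : f \in admissible) (f_t : lam < dev f t).

(** The whole component of [t] lies above [lam >= 0], and there [|2 * lam - z| <= z]: reflected
    entries move towards the centre of their box. *)
Lemma mirror_box i :
  box i (if connect (rigid f) t i then sg i + lam - (f i)%:Z else (f i)%:Z).
Proof.
have [fb _] := admissibleP _ f_adm; case: ifP => // ti.
apply: box_closed (fb i); have := rigid_above f_adm ti.
by rewrite f_t /dev; lia.
Qed.

Lemma mirrorE i : (mirror t f i)%:Z =
  if connect (rigid f) t i then sg i + lam - (f i)%:Z else (f i)%:Z.
Proof. by rewrite retargetE //; apply: box_range (mirror_box i). Qed.

Lemma dev_mirror i : dev (mirror t f) i =
  if connect (rigid f) t i then 2 * lam - dev f i else dev f i.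
Proof. by rewrite /dev mirrorE; case: ifP; lia. Qed.

Lemma rigid_boundary i j :
  connect (rigid f) t i -> ~~ connect (rigid f) t j -> ~~ rigid f i j.
Proof.
by move=> ti; apply: contra => ij; apply: connect_trans ti (connect1 ij).
Qed.

Lemma mirror_admissible : mirror t f \in admissible.
Proof.
have [fb fc] := admissibleP _ f_adm.
apply/admissibleP; split=> [i|i j]; first by rewrite mirrorE mirror_box.
have := fc i j; rewrite !dev_mirror.
case: (boolP (connect _ t i)) => ti; case: (boolP (connect _ t j)) => tj //=.
- lia.
- by have := rigid_boundary ti tj; rewrite /rigid; lia.
- by have := rigid_boundary tj ti; rewrite rigid_sym /rigid; lia.
Qed.

(** Reflecting both ends only changes the sign of [2 * lam - z i - z j]. Reflecting one end turns
    it, up to sign, into [z i - z j], which is within [c i j]; such a pair was not rigid before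
    either, being on the boundary of the component. *)
Lemma rigid_mirror : rigid (mirror t f) =2 rigid f.
Proof.
have [_ fc] := admissibleP _ f_adm => i j; have := fc i j.
rewrite [LHS]/rigid !dev_mirror.
case: (boolP (connect _ t i)) => ti; case: (boolP (connect _ t j)) => tj //=.
- by rewrite /rigid; lia.
- by rewrite (negbTE (rigid_boundary ti tj)); lia.
- by rewrite rigid_sym (negbTE (rigid_boundary tj ti)); lia.
Qed.

Lemma mirrorK : mirror t (mirror t f) = f.
Proof.
have [fb _] := admissibleP _ f_adm.
apply/ffunP => i; apply/val_inj/eqP; rewrite /= -eqz_nat retargetE.
  by rewrite (eq_connect rigid_mirror) mirrorE; case: (connect _ t i); lia.
rewrite (eq_connect rigid_mirror) mirrorE; have /box_range := fb i.
by case: (connect _ t i); lia.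
Qed.

End Above.

Lemma card_pinned_mirror s t :
  (#|pinned s t (lam - 1) (lam + 1)| <= #|pinned s t (lam - 1) (lam - 1)|)%N.
Proof.
have above f : f \in pinned s t (lam - 1) (lam + 1) ->
    f \in admissible /\ lam < dev f t.
  by move=> /pinnedP[fA _ ft]; split=> //; lia.
rewrite -(@card_in_imset _ _ (mirror t)); last first.
  apply: (can_in_inj (g := mirror t)) => f /above[fA ft].
  exact: mirrorK.
apply/subset_leq_card/subsetP => _ /imsetP[f fP ->].
have [fA ft] := above f fP; have [_ fs ft1] := pinnedP _ _ _ _ _ fP.
apply/pinnedP; split; first exact: mirror_admissible.
  (* Since [dev f s = lam - 1] is below [lam], [s] is outside the component of [t] and stays
     fixed. *)
  rewrite dev_mirror //; case: ifP => // ts.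
  by have := rigid_above fA ts; lia.
by rewrite dev_mirror // connect0; lia.
Qed.

End Reflection.

(* [clash f g] plays the role of [rigid f] for the exchange of [f] and [g]. *)
Definition clash f g : rel V := fun i j =>
  (c i j < `|dev f i - dev g j|) || (c i j < `|dev g i - dev f j|).

Definition splice t f g : {ffun V -> 'I_n} :=
  [ffun i => if connect (clash f g) t i then g i else f i].

Section Splice.

Variables (t : V) (f g : {ffun V -> 'I_n}).

Lemma clash_sym i j : clash f g i j = clash f g j i.
Proof. by rewrite /clash c_sym orbC ![`|_ - dev _ j|]distrC. Qed.

Lemma clashC : clash f g =2 clash g f.
Proof. by move=> i j; rewrite /clash orbC. Qed.

Lemma clash_boundary i j :
  connect (clash f g) t i -> ~~ connect (clash f g) t j -> ~~ clash f g i j.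
Proof.
by move=> ti; apply: contra => ij; apply: connect_trans ti (connect1 ij).
Qed.

Lemma dev_splice i :
  dev (splice t f g) i = if connect (clash f g) t i then dev g i else dev f i.
Proof. by rewrite /dev ffunE; case: ifP. Qed.

Lemma dev_spliceC i :
  dev (splice t g f) i = if connect (clash f g) t i then dev f i else dev g i.
Proof. by rewrite /dev ffunE -(eq_connect clashC); case: ifP. Qed.

Hypotheses (fA : f \in admissible) (gA : g \in admissible).

(** If the order of [f] and [g] changes between [k] and [l], both mixed differences lie between
    [dev f k - dev f l] and [dev g k - dev g l], so there is no clash. *)
Lemma clash_order i j : connect (clash f g) i j ->
  (dev g i < dev f i) = (dev g j < dev f j).
Proof.
have [[_ fc] [_ gc]] := (admissibleP _ fA, admissibleP _ gA).
apply: (@closed_connect _ _ [pred k | dev g k < dev f k]) => k l.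
by rewrite !inE /clash; have := fc k l; have := gc k l; lia.
Qed.

Lemma splice_admissible : splice t f g \in admissible.
Proof.
have [[fb fc] [gb gc]] := (admissibleP _ fA, admissibleP _ gA).
apply/admissibleP; split=> [i|i j]; first by rewrite ffunE; case: ifP.
rewrite !dev_splice.
case: (boolP (connect _ t i)) => ti; case: (boolP (connect _ t j)) => tj //=.
- by have := clash_boundary ti tj; rewrite /clash; lia.
- by have := clash_boundary tj ti; rewrite clash_sym /clash; lia.
Qed.

(** A pair with one end in the component has its mixed differences replaced by those of [f] and of
    [g], which are admissible; it does not clash after the exchange, nor did it before. *)
Lemma clash_splice : clash (splice t f g) (splice t g f) =2 clash f g.
Proof.
have [[_ fc] [_ gc]] := (admissibleP _ fA, admissibleP _ gA) => i j.
rewrite [LHS]/clash !dev_splice !dev_spliceC.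
have := fc i j; have := gc i j.
case: (boolP (connect _ t i)) => ti; case: (boolP (connect _ t j)) => tj //=.
- by rewrite orbC.
- by rewrite (negbTE (clash_boundary ti tj)); lia.
- by rewrite clash_sym (negbTE (clash_boundary tj ti)); lia.
Qed.

Lemma spliceK : splice t (splice t f g) (splice t g f) = f.
Proof.
apply/ffunP => i; rewrite ffunE (eq_connect clash_splice) !ffunE.
by rewrite -(eq_connect clashC); case: (connect _ t i).
Qed.

End Splice.

Lemma card_pinned_splice s t p p' r r' : p < p' -> r < r' ->
  (#|pinned s t p r'| * #|pinned s t p' r|
     <= #|pinned s t p r| * #|pinned s t p' r'|)%N.
Proof.
move=> ltp ltr; rewrite -!cardsX.
pose sw (fg : {ffun V -> 'I_n} * {ffun V -> 'I_n}) :=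
  (splice t fg.1 fg.2, splice t fg.2 fg.1).
rewrite -(@card_in_imset _ _ sw); last first.
  apply: (can_in_inj (g := sw)) => -[f g].
  rewrite in_setX => /andP[/pinnedP[fA _ _] /pinnedP[gA _ _]].
  by rewrite /sw /= !spliceK.
apply/subset_leq_card/subsetP => _ /imsetP[[f g] + ->].
rewrite !in_setX /= => /andP[/pinnedP[fA fs ft] /pinnedP[gA gs gt]].
(* [f] is below [g] at [s] and above it at [t], so the exchange around [t] leaves the values at [s]
   alone. *)
have ts : connect (clash f g) t s = false.
  by apply/negP => /(clash_order fA gA); lia.
apply/andP; split; apply/pinnedP; split; rewrite ?splice_admissible //.
- by rewrite dev_splice ts.
- by rewrite dev_splice connect0.
- by rewrite dev_spliceC ts.
- by rewrite dev_spliceC connect0.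
Qed.

(** This is [z -> - z]; for a pair with sum [sg] it sends [f] to its partner [g]. *)
Definition opposite f : {ffun V -> 'I_n} :=
  retarget f (fun i => sg i - (f i)%:Z).

Lemma oppositeE f i : f \in admissible -> (opposite f i)%:Z = sg i - (f i)%:Z.
Proof.
move=> /admissibleP[fb _]; rewrite retargetE //; apply: (@box_range i).
by apply: box_closed (fb i); lia.
Qed.

Lemma dev_opposite f i : f \in admissible -> dev (opposite f) i = - dev f i.
Proof. by move=> fA; rewrite /dev oppositeE //; lia. Qed.

Lemma opposite_admissible f : f \in admissible -> opposite f \in admissible.
Proof.
move=> fA; have [fb fc] := admissibleP _ fA.
apply/admissibleP; split=> [i|i j].
  by rewrite oppositeE //; apply: box_closed (fb i); lia.
by rewrite !dev_opposite //; have := fc i j; lia.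
Qed.

Lemma opposite_inj : {in admissible &, injective opposite}.
Proof.
move=> f g fA gA /ffunP fg; apply/ffunP => i; apply/val_inj => /=.
by have := oppositeE i fA; rewrite fg oppositeE //; lia.
Qed.

Lemma card_pinned_opp s t p r :
  (#|pinned s t p r| <= #|pinned s t (- p) (- r)|)%N.
Proof.
rewrite -(@card_in_imset _ _ opposite); last first.
  by move=> f g /pinnedP[fA _ _] /pinnedP[gA _ _]; exact: opposite_inj.
apply/subset_leq_card/subsetP => _ /imsetP[f /pinnedP[fA fs ft] ->].
by apply/pinnedP; rewrite opposite_admissible // !dev_opposite // fs ft.
Qed.

Lemma card_pinnedN s t p r : #|pinned s t p r| = #|pinned s t (- p) (- r)|.
Proof.
apply/eqP; rewrite eqn_leq card_pinned_opp /=.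
by have := card_pinned_opp s t (- p) (- r); rewrite !opprK.
Qed.

Lemma card_pinned_exchange_pos s t p : -1 <= p ->
  (#|pinned s t p (p + 2)| + #|pinned s t (p + 2) p|
     <= #|pinned s t p p| + #|pinned s t (p + 2) (p + 2)|)%N.
Proof.
move=> p_ge; have lam_ge0 : 0 <= p + 1 by lia.
have := card_pinned_mirror lam_ge0 s t.
have := card_pinned_mirror lam_ge0 t s.
rewrite (pinnedC t) (pinnedC t s (p + 1 - 1) (p + 1 - 1)).
rewrite addrK -addrA; move=> H1 H2; apply: addn_le_of_minor => //.
by apply: card_pinned_splice; lia.
Qed.

Lemma card_pinned_exchange s t p :
  (#|pinned s t p (p + 2)| + #|pinned s t (p + 2) p|
     <= #|pinned s t p p| + #|pinned s t (p + 2) (p + 2)|)%N.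
Proof.
have [/card_pinned_exchange_pos->//|p_lt] := lerP (-1) p.
(* Here [- (p + 2) >= 0], and negation carries the levels [- (p + 2)] and [- p] to [p + 2] and [p],
   permuting the four counts. *)
have := @card_pinned_exchange_pos s t (- (p + 2)); rewrite opprD subrK -opprD.
rewrite -!card_pinnedN => /(_ ltac:(lia)) le_p.
by rewrite addnC [leqRHS]addnC.
Qed.

(** * Summation over the levels *)

Definition tilted s t (e : int) : {set {ffun V -> 'I_n}} :=
  [set f in admissible | dev f t - dev f s == e].

Lemma card_tilted_opp s t e : (#|tilted s t e| <= #|tilted s t (- e)|)%N.
Proof.
rewrite -(@card_in_imset _ _ opposite); last first.
  by move=> f g /setIdP[fA _] /setIdP[gA _]; exact: opposite_inj.
apply/subset_leq_card/subsetP => _ /imsetP[f /setIdP[fA /eqP fe] ->].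
apply/setIdP; rewrite opposite_admissible // !dev_opposite // -fe.
by split; lia.
Qed.

Theorem card_tilted_le s t : (#|tilted s t 2| <= #|tilted s t 0|)%N.
Proof.
(* [M] bounds the deviations at [s] and [t] in absolute value, and [K = 2 * M + 1] is the number of
   integers from [- M] to [M]. *)
pose M : int := (n.*2)%:Z + `|sg s| + `|sg t|; pose K := (absz (2 * M)).+1.
have devM u f : (u == s) || (u == t) -> 0 <= dev f u + M < K%:Z.
  have := ltn_ord (f u); rewrite /dev /K /M => + /orP[] /eqP us; rewrite us.
    lia.
  lia.
have up : (#|tilted s t 2|
    <= \sum_(i < K) #|pinned s t (i%:Z - M) (i%:Z - M + 2)|)%N.
  apply: leq_trans (card_le_sum_fiber (key := dev^~ s) (M := M) (K := K) _) _.
    by move=> f _; rewrite devM // eqxx.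
  apply: leq_sum => i _; apply/subset_leq_card/subsetP => f.
  move=> /setIdP[/setIdP[fA /eqP fe] /eqP fi].
  by apply/pinnedP; split=> //; lia.
have down : (#|tilted s t (-2)|
    <= \sum_(i < K) #|pinned s t (i%:Z - M + 2) (i%:Z - M)|)%N.
  apply: leq_trans (card_le_sum_fiber (key := dev^~ t) (M := M) (K := K) _) _.
    by move=> f _; rewrite devM // eqxx orbT.
  apply: leq_sum => i _; apply/subset_leq_card/subsetP => f.
  move=> /setIdP[/setIdP[fA /eqP fe] /eqP fi].
  by apply/pinnedP; split=> //; lia.
have flat : (\sum_(i < K) #|pinned s t (i%:Z - M) (i%:Z - M)|
    <= #|tilted s t 0|)%N.
  apply: leq_trans (sum_card_fiber_le _ (dev^~ s) M K).
  apply: leq_sum => i _; apply/subset_leq_card/subsetP => f.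
  move=> /pinnedP[fA fs ft].
  by apply/setIdP; split; [apply/setIdP; split=> //|]; lia.
(* The diagonal counts are summed a second time with the window moved by 2, to match the terms
   [W (p + 2) (p + 2)]. *)
have flat2 : (\sum_(i < K) #|pinned s t (i%:Z - M + 2) (i%:Z - M + 2)|
    <= #|tilted s t 0|)%N.
  apply: leq_trans (sum_card_fiber_le _ (fun f => dev f s - 2) M K).
  apply: leq_sum => i _; apply/subset_leq_card/subsetP => f.
  move=> /pinnedP[fA fs ft].
  by apply/setIdP; split; [apply/setIdP; split=> //|]; lia.
(* By symmetry both off-diagonal sums bound the number of [f] with tilt 2, so the termwise exchange
   inequality gives twice the claim. *)
have down2 := leq_trans (card_tilted_opp s t 2) down.
rewrite -leq_double -!addnn; apply: leq_trans (leq_add up down2) _.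
apply: leq_trans (leq_add flat flat2); rewrite -!big_split /=.
by apply: leq_sum => i _; exact: card_pinned_exchange.
Qed.

End Deviation.

(** * Strictly increasing sequences *)

Lemma card_le_fiberwise (T U : finType) (A B : {set T}) (g : T -> U) :
  (forall z, #|[set x in A | g x == z]| <= #|[set x in B | g x == z]|)%N ->
  (#|A| <= #|B|)%N.
Proof.
move=> leAB; rewrite -!sum1_card.
rewrite (partition_big g predT) // (partition_big g predT (P := mem B)) //=.
by apply: leq_sum => z _; rewrite !sum1dep_card.
Qed.

Section StrictSequences.

Variables (a n : nat) (allowed : 'I_a -> int -> bool).

Hypothesis allowed_convex : forall i (u v w : int),
  u <= w <= v -> allowed i u -> allowed i v -> allowed i w.
Hypothesis allowed_range : forall i v, allowed i v -> 0 <= v < n%:Z.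

Implicit Types (f g : {ffun 'I_a -> 'I_n}).

Definition strict_seqs : {set {ffun 'I_a -> 'I_n}} :=
  [set f : {ffun 'I_a -> 'I_n} | [forall i, allowed i (f i)%:Z]
    & [forall i : 'I_a, forall j : 'I_a, (i < j)%N ==> (f i < f j)%N]].

Lemma strict_seqsP f :
  reflect ((forall i, allowed i (f i)%:Z)
           /\ (forall i j : 'I_a, (i < j)%N -> (f i < f j)%N))
          (f \in strict_seqs).
Proof.
rewrite inE; apply: (iffP andP) => -[H1 H2]; split.
- exact/forallP.
- by move=> i j; move/forallP/(_ i)/forallP/(_ j)/implyP: H2.
- exact/forallP.
- by apply/forallP => i; apply/forallP => j; apply/implyP => /H2.
Qed.

Variables (s t : 'I_a).

Definition seq_gap f : int := (f t)%:Z - (f s)%:Z.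

Definition gap_pairs (k1 k2 : int) :
    {set {ffun 'I_a -> 'I_n} * {ffun 'I_a -> 'I_n}} :=
  [set fg in setX strict_seqs strict_seqs
     | seq_gap fg.1 == k1 & seq_gap fg.2 == k2].

Lemma gap_pairsP k1 k2 f g :
  reflect [/\ f \in strict_seqs, g \in strict_seqs,
              seq_gap f = k1 & seq_gap g = k2]
          ((f, g) \in gap_pairs k1 k2).
Proof.
apply: (iffP setIdP) => /=.
  by move=> [+ /andP[/eqP ? /eqP ?]]; rewrite in_setX => /andP[].
by move=> [fS gS -> ->]; rewrite in_setX fS gS !eqxx.
Qed.

(** * Pairs of strict sequences as admissible deviations *)

Section FixedSum.

Variable sg : 'I_a -> nat.

Definition sum_box i (v : int) := allowed i v && allowed i ((sg i)%:Z - v).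

(** For [i < j], strict increase of both [f] and [sg - f] says that [2 * (f j - f i)] lies between
    [2] and [2 * (sg j - sg i) - 2]; subtracting [sg j - sg i] gives a symmetric bound on
    [dev f j - dev f i]. *)
Definition sum_slack (i j : 'I_a) : int :=
  if (i < j)%N then (sg j)%:Z - (sg i)%:Z - 2
  else if (j < i)%N then (sg i)%:Z - (sg j)%:Z - 2 else 0.

Let sgz i := (sg i)%:Z.

Lemma devE f i : dev sgz f i = 2 * (f i)%:Z - (sg i)%:Z.
Proof. by []. Qed.

Lemma sum_slack_sym i j : sum_slack i j = sum_slack j i.
Proof. by rewrite /sum_slack; case: ltngtP. Qed.

(** The hypothesis places [w] and [sg i - w] between [v] and [sg i - v], so convexity of [allowed i]
    applies. *)
Lemma sum_box_closed i (v w : int) :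
  `|2 * w - sgz i| <= `|2 * v - sgz i| -> sum_box i v -> sum_box i w.
Proof.
rewrite /sgz => le_wv /andP[av asv]; apply/andP.
have [le_v|lt_v] := lerP (2 * v) (sg i)%:Z; split.
- by apply: allowed_convex av asv; lia.
- by apply: allowed_convex av asv; lia.
- by apply: allowed_convex asv av; lia.
- by apply: allowed_convex asv av; lia.
Qed.

Lemma sum_box_range i v : sum_box i v -> 0 <= v < n%:Z.
Proof. by case/andP => /allowed_range. Qed.

Definition sum_pairs k1 k2 :=
  [set fg in gap_pairs k1 k2 | [forall i, (fg.1 i + fg.2 i)%N == sg i]].

Lemma sum_pairsP k1 k2 f g :
  reflect ((f, g) \in gap_pairs k1 k2 /\ forall i, (f i + g i)%N = sg i)
          ((f, g) \in sum_pairs k1 k2).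
Proof.
apply: (iffP setIdP) => -[fgP H]; split=> //=.
  by move=> i; apply/eqP; move/forallP: H.
by apply/forallP => i; apply/eqP.
Qed.

Lemma fst_admissible f g : f \in strict_seqs -> g \in strict_seqs ->
  (forall i, (f i + g i)%N = sg i) -> f \in admissible n sgz sum_box sum_slack.
Proof.
move=> /strict_seqsP[fa fI] /strict_seqsP[ga gI] fg.
apply/admissibleP; split=> [i|i j].
  have gE : (sg i)%:Z - (f i)%:Z = (g i)%:Z by have := fg i; lia.
  by rewrite /sum_box gE fa ga.
rewrite !devE /sum_slack; have := fg i; have := fg j.
have [ij|ji|/val_inj <-] := ltngtP i j; last lia.
  by have := fI _ _ ij; have := gI _ _ ij; lia.
by have := fI _ _ ji; have := gI _ _ ji; lia.
Qed.

Lemma admissible_strict f :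
  f \in admissible n sgz sum_box sum_slack -> f \in strict_seqs.
Proof.
move=> /admissibleP[fb fc]; apply/strict_seqsP; split=> [i|i j ij].
  by have /andP[] := fb i.
by have := fc i j; rewrite !devE /sum_slack ij; lia.
Qed.

Definition co_seq f : {ffun 'I_a -> 'I_n} := opposite sgz f.

Lemma add_co_seq f : f \in admissible n sgz sum_box sum_slack ->
  forall i, (f i + co_seq f i)%N = sg i.
Proof.
move=> fA i; have : (co_seq f i)%:Z = (sg i)%:Z - (f i)%:Z.
  exact: (oppositeE sum_box_closed sum_box_range i fA).
by lia.
Qed.

Lemma card_sum_pairs (k : int) :
  (#|sum_pairs (k + 1) (k - 1)| <= #|sum_pairs k k|)%N.
Proof.
have [->|[[f0 g0] /sum_pairsP[/gap_pairsP[_ _ gf gg] fg0]]] :=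
  set_0Vmem (sum_pairs (k + 1) (k - 1)); first by rewrite cards0.
(* Adding the gaps of one witness determines [sg t - sg s]; hence a gap [k + 1] of [f] is a tilt 2,
   and a gap [k] a tilt 0. *)
have sg_st : sgz t - sgz s = 2 * k.
  by move: gf gg; rewrite /sgz /seq_gap; have := fg0 s; have := fg0 t; lia.
have le1 : (#|sum_pairs (k + 1) (k - 1)|
    <= #|tilted n sgz sum_box sum_slack s t 2|)%N.
  rewrite -(@card_in_imset _ _ fst); last first.
    move=> [f g] [f' g'] /sum_pairsP[_ fg] /sum_pairsP[_ fg'] /= ff'.
    rewrite -ff' in fg' *; congr (_, _); apply/ffunP => i.
    by apply/val_inj => /=; have := fg i; have := fg' i; lia.
  apply/subset_leq_card/subsetP => _ /imsetP[[f g] fgP ->] /=.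
  have [/gap_pairsP[fS gS kf kg] fg] := sum_pairsP _ _ _ _ fgP.
  apply/setIdP; split; first exact: fst_admissible fS gS fg.
  by move: kf sg_st; rewrite !devE /seq_gap /sgz; lia.
apply: leq_trans le1 _.
have := card_tilted_le sum_slack_sym sum_box_closed sum_box_range s t.
move=> /leq_trans; apply.
pose split_sum f := (f, co_seq f).
rewrite -(@card_imset _ _ split_sum); last by move=> f g [].
apply/subset_leq_card/subsetP => _ /imsetP[f /setIdP[fA /eqP fe] ->].
apply/sum_pairsP; split; last by move=> i; exact: add_co_seq.
apply/gap_pairsP; split.
- exact: admissible_strict.
- apply: admissible_strict.
  exact (opposite_admissible sum_box_closed sum_box_range fA).
- by move: fe sg_st; rewrite !devE /seq_gap /sgz; lia.
- have := add_co_seq fA s; have := add_co_seq fA t.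
  by move: fe sg_st; rewrite !devE /seq_gap /sgz; lia.
Qed.

End FixedSum.

Definition seq_wgt f : nat := (\sum_i (f i).+1)%N.

(** The total weight depends only on the entrywise sum, so [Q] is constant on each fibre of [sums].
    A general [Q] is kept in order to treat the chain [beta] as well, where the condition bears on
    the complementary weight. *)
Lemma card_gap_pairs (Q : pred nat) (k : int) :
  (#|[set fg in gap_pairs (k + 1) (k - 1) | Q (seq_wgt fg.1 + seq_wgt fg.2)%N]|
   <= #|[set fg in gap_pairs k k | Q (seq_wgt fg.1 + seq_wgt fg.2)%N]|)%N.
Proof.
pose sq := {ffun 'I_a -> 'I_n}.
pose sums (fg : sq * sq) : {ffun 'I_a -> 'I_(n + n).+1} :=
  [ffun i => inord (fg.1 i + fg.2 i)].
have sumsP (fg : sq * sq) (z : {ffun 'I_a -> 'I_(n + n).+1}) :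
     reflect (forall i, (fg.1 i + fg.2 i)%N = z i) (sums fg == z).
  have bnd i : (fg.1 i + fg.2 i < (n + n).+1)%N.
    by have := ltn_ord (fg.1 i); have := ltn_ord (fg.2 i); lia.
  apply: (iffP eqP) => [<- i|fgz]; first by rewrite ffunE inordK.
  by apply/ffunP => i; apply/val_inj; rewrite ffunE /= inordK.
have wgtE (fg : sq * sq) :
    (seq_wgt fg.1 + seq_wgt fg.2 = \sum_i (sums fg i).+2)%N.
  rewrite /seq_wgt -big_split; apply: eq_bigr => i _ /=.
  by have /sumsP/(_ i) := eqxx (sums fg); lia.
apply: (@card_le_fiberwise _ _ _ _ sums) => z.
have fiberE k1 k2 : [set fg in [set fg in gap_pairs k1 k2
      | Q (seq_wgt fg.1 + seq_wgt fg.2)%N] | sums fg == z]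
    = if Q (\sum_i (z i).+2)%N then sum_pairs (fun i => z i) k1 k2 else set0.
  apply/setP => -[f g]; case: (boolP (Q _)) => Qz; apply/idP/idP.
  - move=> /setIdP[/setIdP[fgP _] /sumsP fgz]; exact/sum_pairsP.
  - move=> /sum_pairsP[fgP fgz].
    have zE : sums (f, g) == z by exact/sumsP.
    apply/setIdP; split=> //; apply/setIdP; split=> //.
    by rewrite (wgtE (f, g)) (eqP zE).
  - move=> /setIdP[/setIdP[_ +] /eqP zE].
    by rewrite (wgtE (f, g)) zE (negbTE Qz).
  - by rewrite in_set0.
by rewrite !fiberE; case: ifP => // _; exact: card_sum_pairs.
Qed.

End StrictSequences.

(** * Linear extensions of a poset covered by two chains *)

Section LinearExtensions.

Variables (d : Order.disp_t) (X : finPOrderType d).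

Implicit Types (L : {ffun X -> 'I_#|X|}) (u v : X).

Lemma linear_extensionsP L :
  reflect (injective L /\ forall u v, (u < v)%O -> (L u < L v)%N)
          (L \in linear_extensions X).
Proof.
rewrite inE; apply: (iffP and3P) => [[/injectiveP Linj _ /forallP Lmono]|].
  by split=> // u v uv; move/forallP/(_ v)/implyP: (Lmono u); apply.
move=> [Linj Lmono]; split; first exact/injectiveP.
  apply/forallP => j; apply/existsP.
  have : j \in codom L by rewrite (inj_card_onto Linj) ?card_ord.
  by move=> /codomP[u ->]; exists u.
by apply/forallP => u; apply/forallP => v; apply/implyP => /Lmono.
Qed.

Lemma sum_labels L :
  injective L -> (\sum_u label L u = \sum_(j < #|X|) j.+1)%N.
Proof.
move=> Linj; rewrite (reindex L) //=; apply: onW_bij.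
by apply: inj_card_bij Linj _; rewrite card_ord.
Qed.

Lemma rank_linear_extension L u : injective L ->
  (L u : nat) = #|[set v | (L v < L u)%N]|.
Proof.
move=> Linj; rewrite -(card_imset _ Linj).
have Lbij : bijective L by apply: inj_card_bij Linj _; rewrite card_ord.
have -> : L @: [set v | (L v < L u)%N] = [set j : 'I_#|X| | (j < L u)%N].
  have [M _ MK] := Lbij.
  apply/setP => j; rewrite inE; apply/imsetP/idP => [[v + ->]|ju].
    by rewrite inE.
  by exists (M j); rewrite ?inE MK.
rewrite cardE /= -[LHS](size_iota 0); have lt_u := ltn_ord (L u).
rewrite -(size_map val) /=; apply/perm_size/uniq_perm.
- exact: iota_uniq.
- by rewrite (map_inj_uniq val_inj) enum_uniq.
move=> m; rewrite mem_iota add0n /=; apply/idP/mapP => [mu|[j + ->]].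
  by exists (Ordinal (ltn_trans mu lt_u)); rewrite // mem_enum inE.
by rewrite mem_enum inE.
Qed.

End LinearExtensions.

Lemma leq_b2n (b1 b2 : bool) : (b1 -> b2) -> (b1 <= b2)%N.
Proof. by case: b1 => // ->. Qed.

Lemma sum_ltn_ord a m : (m <= a)%N -> (\sum_(i < a) (i < m) = m)%N.
Proof.
move=> le_ma; rewrite -(big_mkord predT (fun i => (i < m) : nat)).
rewrite (@big_cat_nat _ _ _ m) //= !big_nat.
rewrite (eq_bigr (fun=> 1%N)) => [|i /andP[_ ->] //].
rewrite [X in (_ + X)%N]big1 => [|i /andP[mi _]]; last by rewrite ltnNge mi.
by rewrite -big_nat sum_nat_const_nat subn0 muln1 addn0.
Qed.

Lemma ffun_strict_gap a n (f : {ffun 'I_a -> 'I_n}) :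
  (forall i j : 'I_a, (i < j)%N -> (f i < f j)%N) ->
  forall i j : 'I_a, (i <= j)%N -> (f i + (j - i) <= f j)%N.
Proof.
move=> fI i j ij; have [m jE] : exists m, (j = i + m :> nat)%N.
  by exists (j - i)%N; lia.
elim: m j jE {ij} => [|m IHm] j jE.
  by rewrite (_ : j = i); [lia | apply/val_inj => /=; lia].
have lt_im : (i + m < a)%N by have := ltn_ord j; lia.
have := IHm (Ordinal lt_im) erefl; have := fI (Ordinal lt_im) j.
by move: (f (Ordinal lt_im)) => fm /=; lia.
Qed.

(** * Linear extensions read off one chain *)

Section TwoChains.

Variables (d : Order.disp_t) (X : finPOrderType d) (a b : nat).
Variables (alpha : 'I_a -> X) (beta : 'I_b -> X).

Hypothesis alpha_chain : increasing_chain alpha.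
Hypothesis beta_chain : increasing_chain beta.
Hypothesis chains_disjoint : chain_set alpha :&: chain_set beta = set0.
Hypothesis chains_cover : chain_set alpha :|: chain_set beta = [set: X].

Implicit Types (L M : {ffun X -> 'I_#|X|}) (u v : X).
Implicit Types (i : 'I_a) (j : 'I_b) (f : {ffun 'I_a -> 'I_#|X|}).

Lemma increasing_chain_inj m (gamma : 'I_m -> X) :
  increasing_chain gamma -> injective gamma.
Proof.
move=> inc i j ij; apply: val_inj; case: (ltngtP i j) => // /inc.
  by rewrite ij ltxx.
by rewrite ij ltxx.
Qed.

Let alpha_inj := increasing_chain_inj alpha_chain.
Let beta_inj := increasing_chain_inj beta_chain.

Lemma increasing_chain_lt m (gamma : 'I_m -> X) (i j : 'I_m) :
  increasing_chain gamma -> (gamma i < gamma j)%O = (i < j)%N.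
Proof.
move=> inc; apply/idP/idP => [lt_ij|]; last exact: inc.
case: (ltngtP i j) => // [/inc lt_ji|/val_inj ij].
  by have := lt_trans lt_ij lt_ji; rewrite ltxx.
by move: lt_ij; rewrite ij ltxx.
Qed.

Lemma alpha_neq_beta i j : alpha i <> beta j.
Proof.
move=> ij; have : alpha i \in chain_set alpha :&: chain_set beta.
  by rewrite in_setI {2}ij !imset_f.
by rewrite chains_disjoint in_set0.
Qed.

Variant chain_spec : X -> Prop :=
  | InAlpha i : chain_spec (alpha i)
  | InBeta j : chain_spec (beta j).

Lemma chainP u : chain_spec u.
Proof.
have : u \in chain_set alpha :|: chain_set beta by rewrite chains_cover.
by rewrite in_setU => /orP[] /imsetP[k _ ->]; constructor.
Qed.

Lemma sum_chains (F : X -> nat) :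
  (\sum_u F u = \sum_i F (alpha i) + \sum_j F (beta j))%N.
Proof.
transitivity (\sum_(u in [predU chain_set alpha & chain_set beta]) F u)%N.
  apply: eq_bigl => u; rewrite [RHS]inE -[RHS]in_setU chains_cover.
  by rewrite in_setT.
rewrite bigU; last by rewrite -setI_eq0 chains_disjoint.
by rewrite !big_imset //= => ? ? _ _; [move/beta_inj | move/alpha_inj].
Qed.

Lemma card_chains : #|X| = (a + b)%N.
Proof.
by have := sum_chains (fun=> 1%N); rewrite !sum_nat_const !muln1 !card_ord.
Qed.

Lemma rank_chains L u : injective L ->
  (L u = \sum_i (L (alpha i) < L u) + \sum_j (L (beta j) < L u) :> nat)%N.
Proof.
move=> Linj; rewrite {1}(rank_linear_extension u Linj).
rewrite -(sum_chains (fun v => (L v < L u)%N)).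
by rewrite -sum1dep_card big_mkcond; apply: eq_bigr => v _; case: ltnP.
Qed.

Section Extension.

Variable L : {ffun X -> 'I_#|X|}.
Hypothesis L_ext : L \in linear_extensions X.

Let L_inj : injective L.
Proof. by case/linear_extensionsP: L_ext. Qed.

Let L_mono u v : (u < v)%O -> (L u < L v)%N.
Proof. by case/linear_extensionsP: L_ext => _; apply. Qed.

Lemma ext_chain_lt m (gamma : 'I_m -> X) (i j : 'I_m) :
  increasing_chain gamma -> (L (gamma i) < L (gamma j))%N = (i < j)%N.
Proof.
move=> inc; apply/idP/idP => [|/inc/L_mono //].
by case: (ltngtP i j) => // [/inc/L_mono|/val_inj->]; lia.
Qed.

Lemma ext_alpha i :
  (L (alpha i) = i + \sum_j (L (beta j) < L (alpha i)) :> nat)%N.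
Proof.
rewrite {1}(rank_chains (alpha i) L_inj); congr (_ + _)%N.
rewrite -[RHS](sum_ltn_ord (ltnW (ltn_ord i))).
by apply: eq_bigr => k _; rewrite ext_chain_lt.
Qed.

Lemma ext_beta j :
  (L (beta j) = j + \sum_i (L (alpha i) < L (beta j)) :> nat)%N.
Proof.
rewrite {1}(rank_chains (beta j) L_inj) addnC; congr (_ + _)%N.
rewrite -[RHS](sum_ltn_ord (ltnW (ltn_ord j))).
by apply: eq_bigr => k _; rewrite ext_chain_lt.
Qed.

(** By [ext_alpha], [L (alpha i) - i] counts the [beta] elements placed before [alpha i]. They form
    an initial segment of the chain, so [beta j] is not among them exactly when there are at most
    [j]. *)
Lemma ext_alpha_lt_beta i j :
  (L (alpha i) < L (beta j))%N = (L (alpha i) <= i + j)%N.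
Proof.
rewrite [in RHS]ext_alpha leq_add2l.
have [ij|ji|/val_inj/L_inj/alpha_neq_beta//] :=
  ltngtP (L (alpha i)) (L (beta j)).
  rewrite -[X in (_ <= X)%N](sum_ltn_ord (ltnW (ltn_ord j))).
  symmetry; apply: leq_sum => k _.
  apply: leq_b2n => ki; rewrite -(ext_chain_lt _ _ beta_chain).
  exact: ltn_trans ki ij.
symmetry; apply/negbTE; rewrite -ltnNge.
rewrite -[X in (X <= _)%N](sum_ltn_ord (ltn_ord j)); apply: leq_sum => k _.
apply: leq_b2n => kj; apply: leq_ltn_trans ji.
have [kj'|jk|/val_inj->//] := ltngtP k j; last lia.
by apply: ltnW; rewrite ext_chain_lt.
Qed.

End Extension.

(** Each relation between [alpha i] and some [beta j] is translated by [ext_alpha_lt_beta] into an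
    upper or a lower bound on [f i], so the allowed values form an interval. *)
Definition alpha_box i (v : int) : bool :=
  (0 <= v < #|X|%:Z) &&
  [forall j, ((alpha i < beta j)%O ==> (v <= (i + j)%:Z))
          && ((beta j < alpha i)%O ==> ((i + j)%:Z < v))].

Lemma alpha_box_convex i (u v w : int) :
  u <= w <= v -> alpha_box i u -> alpha_box i v -> alpha_box i w.
Proof.
move=> uwv /andP[u_rg /forallP ub] /andP[v_rg /forallP vb].
apply/andP; split; first lia.
apply/forallP => j; move: (ub j) (vb j).
move=> /andP[_ /implyP uj] /andP[/implyP vj _].
by apply/andP; split; apply/implyP; [move/vj | move/uj]; lia.
Qed.

Lemma alpha_box_range i (v : int) : alpha_box i v -> 0 <= v < #|X|%:Z.
Proof. by case/andP. Qed.

Definition on_alpha L : {ffun 'I_a -> 'I_#|X|} := [ffun i => L (alpha i)].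

Lemma on_alpha_strict L :
  L \in linear_extensions X -> on_alpha L \in strict_seqs #|X| alpha_box.
Proof.
move=> LE; have [Linj Lmono] := linear_extensionsP _ LE.
apply/strict_seqsP; split=> [i|i j]; last by rewrite !ffunE ext_chain_lt.
rewrite ffunE /alpha_box; apply/andP; split.
  by have := ltn_ord (L (alpha i)); lia.
apply/forallP => j; apply/andP; split; apply/implyP => /Lmono.
  by rewrite ext_alpha_lt_beta.
by have := ext_alpha_lt_beta LE i j; lia.
Qed.

Lemma on_alpha_inj : {in linear_extensions X &, injective on_alpha}.
Proof.
move=> L M LE ME /ffunP LM.
have LMa i : L (alpha i) = M (alpha i) by have := LM i; rewrite !ffunE.
apply/ffunP => u; case: (chainP u) => [i|j] //; apply: val_inj => /=.
(* The position of [beta j] is [j] plus the number of [alpha] elements before it, and the values on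
   [alpha] decide which those are. *)
rewrite ext_beta // [RHS]ext_beta //; congr (_ + _)%N.
by apply: eq_bigr => i _; rewrite !ext_alpha_lt_beta // LMa.
Qed.

(** * Reconstruction of a linear extension from its values on [alpha] *)

Section Extend.

Variable f : {ffun 'I_a -> 'I_#|X|}.
Hypothesis f_strict : f \in strict_seqs #|X| alpha_box.

Let f_box i : alpha_box i (f i)%:Z.
Proof. by case/strict_seqsP: f_strict. Qed.

Let f_inc (i k : 'I_a) : (i < k)%N -> (f i < f k)%N.
Proof. by case/strict_seqsP: f_strict => _; apply. Qed.

(* [beta j] must be preceded by [j] elements of its own chain and by the
   [alpha i] with [f i <= i + j]; see [ext_alpha_lt_beta]. *)
Definition beta_val (j : 'I_b) : nat := (j + \sum_i (f i <= i + j))%N.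

Definition extend_val u : nat :=
  if [pick i | alpha i == u] is Some i then f i
  else if [pick j | beta j == u] is Some j then beta_val j else 0.

Definition extend : {ffun X -> 'I_#|X|} :=
  [ffun u => insubd (enum_rank u) (extend_val u)].

Lemma beta_val_lt j : (beta_val j < #|X|)%N.
Proof.
have : (\sum_i (f i <= i + j) <= a)%N.
  rewrite -[X in (_ <= X)%N](sum_ltn_ord (leqnn a)).
  by apply: leq_sum => i _; rewrite ltn_ord leq_b1.
by rewrite [ltnRHS]card_chains /beta_val; have := ltn_ord j; lia.
Qed.

Lemma extend_alpha i : extend (alpha i) = f i.
Proof.
apply: val_inj; rewrite ffunE /extend_val.
case: pickP => [k /eqP/alpha_inj->|/(_ i)]; last by rewrite eqxx.
by rewrite val_insubd ltn_ord.
Qed.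

Lemma extend_beta j : extend (beta j) = beta_val j :> nat.
Proof.
rewrite ffunE /extend_val.
case: pickP => [k /eqP/alpha_neq_beta//|_].
case: pickP => [k /eqP/beta_inj->|/(_ j)]; last by rewrite eqxx.
by rewrite val_insubd beta_val_lt.
Qed.

Lemma beta_val_inc (j k : 'I_b) : (j < k)%N -> (beta_val j < beta_val k)%N.
Proof.
move=> jk; rewrite /beta_val -addSn; apply: leq_add => //.
apply: leq_sum => i _.
by apply: leq_b2n; lia.
Qed.

(** As [f] is strictly increasing, [f k - k] is nondecreasing in [k]; so every [k <= i] is counted
    in [beta_val j], which is then at least [j + i + 1]. *)
Lemma lt_beta_val i j : (f i <= i + j)%N -> (f i < beta_val j)%N.
Proof.
move=> fij; suff : (i.+1 <= \sum_k (f k <= k + j))%N by rewrite /beta_val; lia.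
rewrite -[X in (X <= _)%N](sum_ltn_ord (ltn_ord i)); apply: leq_sum => k _.
by apply: leq_b2n => ki; have := ffun_strict_gap f_inc (ki : (k <= i)%N); lia.
Qed.

(** By the same monotonicity only indices [k < i] are counted, so [beta_val j <= i + j]. *)
Lemma beta_val_gt i j : (i + j < f i)%N -> (beta_val j < f i)%N.
Proof.
move=> fij; suff : (\sum_k (f k <= k + j) <= i)%N by rewrite /beta_val; lia.
rewrite -[X in (_ <= X)%N](sum_ltn_ord (ltnW (ltn_ord i))).
apply: leq_sum => k _.
apply: leq_b2n => fkj; rewrite ltnNge; apply/negP => ik.
by have := ffun_strict_gap f_inc ik; lia.
Qed.

Lemma extend_lt u v : (u < v)%O -> (extend u < extend v)%N.
Proof.
case: (chainP u) => [i|j]; case: (chainP v) => [k|k].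
- by rewrite !extend_alpha (increasing_chain_lt _ _ alpha_chain); apply: f_inc.
- move=> ik; rewrite extend_alpha extend_beta; apply: lt_beta_val.
  by have /andP[_ /forallP/(_ k)/andP[/implyP/(_ ik) + _]] := f_box i; lia.
- move=> jk; rewrite extend_alpha extend_beta; apply: beta_val_gt.
  by have /andP[_ /forallP/(_ j)/andP[_ /implyP/(_ jk)]] := f_box k; lia.
- rewrite !extend_beta (increasing_chain_lt _ _ beta_chain).
  exact: beta_val_inc.
Qed.

Lemma extend_inj : injective extend.
Proof.
have ab i j : (extend (alpha i) == extend (beta j) :> nat) = false.
  rewrite extend_alpha extend_beta; apply/negbTE.
  by have [/lt_beta_val|/beta_val_gt] := leqP (f i) (i + j); lia.
move=> u v uv; have {uv} : extend u == extend v :> nat by rewrite uv.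
case: (chainP u) => [i|j]; case: (chainP v) => [k|k].
- have [/alpha_chain|/alpha_chain|/val_inj->//] := ltngtP i k.
    by move=> /extend_lt; lia.
  by move=> /extend_lt; lia.
- by rewrite ab.
- by rewrite eq_sym ab.
- have [/beta_chain|/beta_chain|/val_inj->//] := ltngtP j k.
    by move=> /extend_lt; lia.
  by move=> /extend_lt; lia.
Qed.

Lemma extend_linear : extend \in linear_extensions X.
Proof. exact/linear_extensionsP/(conj extend_inj extend_lt). Qed.

Lemma on_alpha_extend : on_alpha extend = f.
Proof. by apply/ffunP => i; rewrite ffunE extend_alpha. Qed.

End Extend.

Definition ext_gap (x y : X) L : int := (label L y)%:Z - (label L x)%:Z.

Definition ext_pairs (x y : X) (k1 k2 : int) :
    {set {ffun X -> 'I_#|X|} * {ffun X -> 'I_#|X|}} :=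
  [set LM in setX (linear_extensions X) (linear_extensions X)
     | ext_gap x y LM.1 == k1 & ext_gap x y LM.2 == k2].

(** Restriction to [alpha] in both components is a bijection onto pairs of strict sequences, with
    inverse [extend], and it preserves gaps and weights. *)
Lemma card_ext_pairs (Q : pred nat) (s t : 'I_a) (k : int) :
  (#|[set LM in ext_pairs (alpha s) (alpha t) (k + 1) (k - 1)
        | Q (wgt alpha LM.1 + wgt alpha LM.2)%N]|
   <= #|[set LM in ext_pairs (alpha s) (alpha t) k k
        | Q (wgt alpha LM.1 + wgt alpha LM.2)%N]|)%N.
Proof.
have wgtE L : seq_wgt (on_alpha L) = wgt alpha L.
  by apply: eq_bigr => i _; rewrite ffunE.
have gapE L : seq_gap s t (on_alpha L) = ext_gap (alpha s) (alpha t) L.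
  by rewrite /seq_gap /ext_gap !ffunE /label; lia.
pose res (LM : {ffun X -> 'I_#|X|} * {ffun X -> 'I_#|X|}) :=
  (on_alpha LM.1, on_alpha LM.2).
have imE k1 k2 :
    res @: [set LM in ext_pairs (alpha s) (alpha t) k1 k2
             | Q (wgt alpha LM.1 + wgt alpha LM.2)%N]
  = [set fg in gap_pairs #|X| alpha_box s t k1 k2
      | Q (seq_wgt fg.1 + seq_wgt fg.2)%N].
  apply/setP => -[f g]; apply/imsetP/idP => [[[L M] + [-> ->]]|].
    move=> /setIdP[/setIdP[+ /andP[Lk Mk]] QLM].
    rewrite in_setX => /andP[LE ME]; apply/setIdP; split; last by rewrite /= !wgtE.
    by apply/gap_pairsP; rewrite !on_alpha_strict // !gapE (eqP Lk) (eqP Mk).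
  move=> /setIdP[/gap_pairsP[fS gS kf kg] Qfg].
  exists (extend f, extend g); last by rewrite /res /= !on_alpha_extend.
  apply/setIdP; split; last first.
    by rewrite /= -!wgtE !on_alpha_extend.
  apply/setIdP; rewrite in_setX !extend_linear //= -!gapE !on_alpha_extend.
  by rewrite kf kg !eqxx.
have resI k1 k2 : {in [set LM in ext_pairs (alpha s) (alpha t) k1 k2
    | Q (wgt alpha LM.1 + wgt alpha LM.2)%N] &, injective res}.
  move=> [L M] [L' M'] /setIdP[/setIdP[+ _] _] /setIdP[/setIdP[+ _] _].
  rewrite !in_setX => /andP[LE ME] /andP[LE' ME'] [LL MM].
  by congr (_, _); apply: on_alpha_inj.
rewrite -(card_in_imset (resI _ _)) -(card_in_imset (resI k k)) !imE.
exact (card_gap_pairs alpha_box_convex alpha_box_range s t Q k).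
Qed.

Lemma wgt_chains L : L \in linear_extensions X ->
  (wgt alpha L + wgt beta L = \sum_(i < #|X|) i.+1)%N.
Proof.
by move=> /linear_extensionsP[Linj _]; rewrite -(sum_labels Linj) sum_chains.
Qed.

End TwoChains.

(** * Coefficients of the products *)

Lemma coef_Fq_mul (d : Order.disp_t) (X : finPOrderType d) (a : nat)
    (alpha : 'I_a -> X) (x y : X) (k1 k2 : int) (c : nat) :
  (Fq alpha x y k1 * Fq alpha x y k2)`_c
  = #|[set LM in ext_pairs x y k1 k2
        | (wgt alpha LM.1 + wgt alpha LM.2)%N == c]|%:R.
Proof.
rewrite /Fq big_distrlr pair_big_dep /= coef_sum.
under eq_bigr => LM _ do rewrite -exprD coefXn.
rewrite -natr_sum; congr (_%:R).
rewrite -[RHS]sum1_card big_mkcond [RHS]big_mkcond /=.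
apply: eq_bigr => -[L M] _; rewrite [(L, M) \in _]inE [(L, M) \in _]inE in_setX.
rewrite /ext_gap /= andbACA [c == _]eq_sym.
by case: ifP => /= _ //; case: eqP.
Qed.

Theorem theorem1p4 (d : Order.disp_t) (X : finPOrderType d)
    (a b : nat) (alpha : 'I_a -> X) (beta : 'I_b -> X) (x y : X)
    (width2 : width X = 2%N)
    (alpha_chain : increasing_chain alpha)
    (beta_chain : increasing_chain beta)
    (chains_disjoint : chain_set alpha :&: chain_set beta = set0)
    (chains_cover : chain_set alpha :|: chain_set beta = [set: X])
    (neq_xy : x <> y)
    (same_chain : (x \in chain_set alpha /\ y \in chain_set alpha) \/
                  (x \in chain_set beta /\ y \in chain_set beta)) :
  forall k : int, 1 < k ->
    poly_le (Fq alpha x y (k - 1) * Fq alpha x y (k + 1))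
            (Fq alpha x y k ^+ 2).
Proof.
move=> k _ c; rewrite coefB subr_ge0 mulrC expr2 !coef_Fq_mul ler_nat.
case: same_chain => -[/imsetP[s _ ->] /imsetP[t _ ->]].
  exact: (card_ext_pairs alpha_chain beta_chain chains_disjoint chains_cover
            (pred1 c)).
rewrite setIC in chains_disjoint; rewrite setUC in chains_cover.
(* For each extension the weights along the two chains add up to [N], so the [alpha] weights of a
   pair sum to [c] exactly when [c] plus its [beta] weights is [N + N]. *)
pose N := (\sum_(i < #|X|) i.+1)%N.
have wgtE k1 k2 :
    [set LM in ext_pairs (beta s) (beta t) k1 k2
      | (wgt alpha LM.1 + wgt alpha LM.2)%N == c]
  = [set LM in ext_pairs (beta s) (beta t) k1 k2
      | (c + (wgt beta LM.1 + wgt beta LM.2) == N + N)%N].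
  apply/setP => -[L M]; rewrite [LHS]inE [RHS]inE.
  case: (boolP ((L, M) \in _)) => //= /setIdP[+ _]; rewrite in_setX => /andP[].
  move=> /(wgt_chains beta_chain alpha_chain chains_disjoint chains_cover) LE.
  move=> /(wgt_chains beta_chain alpha_chain chains_disjoint chains_cover) ME.
  by rewrite /= /N; lia.
rewrite !wgtE.
exact: (card_ext_pairs beta_chain alpha_chain chains_disjoint chains_cover
          (fun w => (c + w == N + N)%N)).
Qed.
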